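(* Let $P$ be a finite thin poset with balanced coloring $c$ and let $F:P\to\mathcal{A}$ be a functor, where $\mathcal{A}$ is an abelian category. Suppose that $\mathcal{I}$ is an upper or lower order ideal in $P$ and that there is a complete acyclic matching $M$ on (the Hasse diagram of) $\mathcal{I}$ such that $F(e)$ is an isomorphism for each $e\in M$. Then \[H^*(F,c)\cong H^*(F|_{P\setminus\mathcal{I}},\,c|_{P\setminus\mathcal{I}}).\]
   Context: For a poset $P$, write $x\lessdot y$ if $y$ covers $x$; let $C(P)$ be the set of cover relations. $P$ is graded if there is $\mathrm{rk}:P\to\mathbb{N}$ with $\mathrm{rk}(y)=\mathrm{rk}(x)+1$ whenever $x\lessdot y$. A graded poset is thin if every nonempty closed interval $[x,y]=\{z: x\le z\le y\}$ with $\mathrm{rk}(y)=\mathrm{rk}(x)+2$ has exactly 4 elements (such an interval is called a diamond). A balanced coloring is a function $c:C(P)\to\{+1,-1\}$ such that each diamond contains an odd number of cover relations colored $-1$. $P$ is viewed as a category with a unique morphism $x\to y$ iff $x\le y$; $F(x\lessdot y)$ is the morphism $F(x)\to F(y)$. The cochain complex $C^*(F,c)$ is \[C^k(F,c)=\bigoplus_{\mathrm{rk}(x)=k}F(x),\qquad \delta^k=\sum_{x\lessdot y,\ \mathrm{rk}(x)=k}c(x\lessdot y)F(x\lessdot y),\] and $H^*(F,c)$ is its cohomology. An upper (resp. lower) order ideal is an upward (resp. downward) closed subset. An upper or lower order ideal of $P$, and its complement, is a thin poset with the restricted order, rank function and coloring, so the complexes of the restricted functors are defined in the same way. The Hasse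 diagram of a finite poset is the directed graph with vertices the elements and an edge $x\to y$ whenever $x\lessdot y$. A matching $M$ on a directed graph $D$ is a collection of pairwise disjoint edges; it is complete if every vertex of $D$ is incident with an edge in $M$; it is acyclic if the directed graph $D^M$, obtained from $D$ by reversing all edges in $M$, has no directed cycles. For an edge $e=(x\lessdot y)$, $F(e)=F(x\lessdot y)$. *)

(* Defs.v *)
From HB Require Import structures.
From mathcomp Require Import all_boot all_order all_algebra.

Set Implicit Arguments.
Unset Strict Implicit.
Unset Printing Implicit Defensive.

Import Order.TTheory GRing.Theory Num.Theory.
Local Open Scope ring_scope.

Declare Scope cat_scope.
Delimit Scope cat_scope with cat.

Record preaddCat := PreaddCat {
  ob :> Type;
  hom : ob -> ob -> zmodType;
  idc : forall a, hom a a;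
  comp : forall a b c, hom b c -> hom a b -> hom a c;
  compA : forall a b c d (h : hom c d) (g : hom b c) (f : hom a b),
    comp h (comp g f) = comp (comp h g) f;
  comp1c : forall a b (f : hom a b), comp (idc b) f = f;
  compc1 : forall a b (f : hom a b), comp f (idc a) = f;
  compDl : forall a b c (g g' : hom b c) (f : hom a b),
    comp (g + g') f = comp g f + comp g' f;
  compDr : forall a b c (g : hom b c) (f f' : hom a b),
    comp g (f + f') = comp g f + comp g f'
}.

Arguments hom {_} _ _.
Arguments idc {_} _.
Arguments comp {_ _ _ _} _ _.
Notation "g \oc f" := (comp g f) (at level 40, left associativity) : cat_scope.
Local Open Scope cat_scope.

Section Preadditive.
Context {C : preaddCat}.

Definition is_iso (a b : C) (f : hom a b) : Prop :=
  exists g : hom b a, g \oc f = idc a /\ f \oc g = idc b.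

Definition isomorphic (a b : C) : Prop := exists f : hom a b, is_iso f.

Definition is_mono (a b : C) (f : hom a b) : Prop :=
  forall x (u v : hom x a), f \oc u = f \oc v -> u = v.

Definition is_epi (a b : C) (f : hom a b) : Prop :=
  forall x (u v : hom b x), u \oc f = v \oc f -> u = v.

Definition is_kernel (a b : C) (f : hom a b) (k : C) (i : hom k a) : Prop :=
  f \oc i = 0 /\
  forall x (u : hom x a), f \oc u = 0 -> exists! v : hom x k, i \oc v = u.

Definition is_cokernel (a b : C) (f : hom a b) (k : C) (p : hom b k) : Prop :=
  p \oc f = 0 /\
  forall x (u : hom b x), u \oc f = 0 -> exists! v : hom k x, v \oc p = u.

Record kernel_of (a b : C) (f : hom a b) := Kernel {
  ker_ob : C;
  ker_map : hom ker_ob a;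
  ker_mapP : is_kernel f ker_map
}.

Record cokernel_of (a b : C) (f : hom a b) := Cokernel {
  coker_ob : C;
  coker_map : hom b coker_ob;
  coker_mapP : is_cokernel f coker_map
}.

Record biproduct_of (I : finType) (X : I -> C) := Biproduct {
  bip_ob : C;
  bip_inj : forall i, hom (X i) bip_ob;
  bip_prj : forall i, hom bip_ob (X i);
  bip_prj_inj : forall i, bip_prj i \oc bip_inj i = idc (X i);
  bip_prj_inj0 : forall i j, i != j -> bip_prj j \oc bip_inj i = 0;
  bip_inj_prj : \sum_i bip_inj i \oc bip_prj i = idc bip_ob
}.

End Preadditive.

(* Kernels, cokernels and finite biproducts are chosen; the biproduct of an
   empty family is a zero object. *)
Record abelianCat := AbelianCat {
  ab_cat :> preaddCat;
  biproduct : forall (I : finType) (X : I -> ab_cat), biproduct_of X;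
  kernel : forall (a b : ab_cat) (f : hom a b), kernel_of f;
  cokernel : forall (a b : ab_cat) (f : hom a b), cokernel_of f;
  mono_normal : forall (a b : ab_cat) (f : hom a b), is_mono f ->
    exists (c : ab_cat) (g : hom b c), is_kernel g f;
  epi_normal : forall (a b : ab_cat) (f : hom a b), is_epi f ->
    exists (c : ab_cat) (g : hom c a), is_cokernel g f
}.

Arguments biproduct {_ _} _.
Arguments kernel {_ _ _} _.
Arguments cokernel {_ _ _} _.

Section Cohomology.
Context {A : abelianCat}.

Lemma ker_lift_ex (x a b : A) (g : hom a b) (u : hom x a) :
  g \oc u = 0 -> exists v, ker_map (kernel g) \oc v == u.
Proof.
move=> gu; have [_ /(_ _ _ gu) [v [vE _]]] := ker_mapP (kernel g).
by exists v; apply/eqP.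
Qed.

Definition ker_lift (x a b : A) (g : hom a b) (u : hom x a) (gu : g \oc u = 0)
  : hom x (ker_ob (kernel g)) := xchoose (ker_lift_ex gu).

Lemma ker_liftE (x a b : A) (g : hom a b) (u : hom x a) (gu : g \oc u = 0) :
  ker_map (kernel g) \oc ker_lift gu = u.
Proof. exact/eqP/(xchooseP (ker_lift_ex gu)). Qed.

(* ker g / im f, as the cokernel of the map a -> ker g induced by f. *)
Definition homology (a b c : A) (f : hom a b) (g : hom b c) (gf : g \oc f = 0)
  : A := coker_ob (cokernel (ker_lift gf)).

Record cochain_complex := CochainComplex {
  cx_ob :> nat -> A;
  cx_d : forall k, hom (cx_ob k) (cx_ob k.+1);
  cx_dd : forall k, cx_d k.+1 \oc cx_d k = 0
}.

(* The complex is zero in negative degrees, hence H^0 = ker d^0. *)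
Definition cohomology (X : cochain_complex) (k : nat) : A :=
  if k is k'.+1 then homology (cx_dd X k') else ker_ob (kernel (cx_d X 0)).

End Cohomology.

Arguments cochain_complex : clear implicits.

Local Open Scope order_scope.

Section Posets.
Context {d : Order.disp_t} {P : finPOrderType d}.

Definition covers : rel P :=
  fun x y => (x < y) && [forall z : P, ~~ ((x < z) && (z < y))].

Lemma coversW x y : covers x y -> x <= y.
Proof. by case/andP => /ltW. Qed.

Definition interval (x y : P) : {set P} := [set z | x <= z <= y].

Definition is_rank (rk : P -> nat) : Prop :=
  forall x y, covers x y -> rk y = (rk x).+1.

Record is_thin (rk : P -> nat) : Prop := IsThin {
  thin_rank : is_rank rk;
  thin_diamond : forall x y,
    x <= y -> rk y = (rk x).+2 -> #|interval x y| = 4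
}.

(* [c x y] is the color of the cover relation x <. y; the value of c on pairs
   which are not cover relations is irrelevant. *)
Record is_balanced_coloring (rk : P -> nat) (c : P -> P -> int) : Prop :=
  IsBalancedColoring {
    coloring_sign : forall x y, covers x y -> c x y = 1%R \/ c x y = (-1)%R;
    coloring_odd : forall x y, x <= y -> rk y = (rk x).+2 ->
      odd #|[set e : P * P | [&& e.1 \in interval x y, e.2 \in interval x y,
                                 covers e.1 e.2 & c e.1 e.2 == (-1)%R]]|
  }.

Definition upper_ideal (A : {set P}) : Prop :=
  forall x y, x <= y -> x \in A -> y \in A.

Definition lower_ideal (A : {set P}) : Prop :=
  forall x y, x <= y -> y \in A -> x \in A.

Definition order_convex (A : {set P}) : Prop :=
  forall x y z, x <= y -> y <= z -> x \in A -> z \in A -> y \in A.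

Lemma ideal_compl_convex (A : {set P}) :
  upper_ideal A \/ lower_ideal A -> order_convex (~: A).
Proof.
case=> idA x y z xy yz; rewrite !inE => xA zA.
  by apply: contra zA; apply: idA.
by apply: contra xA; apply: idA.
Qed.

End Posets.

Section SubPoset.
Context {d : Order.disp_t} {P : finPOrderType d}.

Definition subposet (A : {set P}) : Type := {x : P | x \in A}.

HB.instance Definition _ (A : {set P}) := SubFinite.on (subposet A).
HB.instance Definition _ (A : {set P}) :=
  [SubChoice_isSubPOrder of subposet A by <: with d].

Variable A : {set P}.

Lemma sub_le (x y : subposet A) : (x <= y) = (val x <= val y).
Proof. by rewrite leEsub. Qed.

Lemma sub_lt (x y : subposet A) : (x < y) = (val x < val y).
Proof. by rewrite ltEsub. Qed.

End SubPoset.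

Record poset_functor d (P : finPOrderType d) (C : preaddCat) := PosetFunctor {
  fob :> P -> C;
  fmor : forall x y, x <= y -> hom (fob x) (fob y);
  fmor_id : forall x, fmor (lexx x) = idc (fob x);
  fmor_comp : forall x y z (xy : x <= y) (yz : y <= z),
    fmor (le_trans xy yz) = fmor yz \oc fmor xy
}.

Arguments fmor {d P C} F {x y} : rename.

Section Restrict.
Context {d : Order.disp_t} {P : finPOrderType d} {C : preaddCat}.
Variables (F : poset_functor P C) (A : {set P}).

Definition restrict_mor (x y : subposet A) (xy : x <= y) :
  hom (F (val x)) (F (val y)) := fmor F (etrans (esym (sub_le x y)) xy).

Lemma restrict_mor_id (x : subposet A) :
  restrict_mor (lexx x) = idc (F (val x)).
Proof.
by rewrite -fmor_id /restrict_mor; congr fmor; apply: bool_irrelevance.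
Qed.

Lemma restrict_mor_comp (x y z : subposet A) (xy : x <= y) (yz : y <= z) :
  restrict_mor (le_trans xy yz) = restrict_mor yz \oc restrict_mor xy.
Proof.
by rewrite -fmor_comp /restrict_mor; congr fmor; apply: bool_irrelevance.
Qed.

Definition restrict : poset_functor (subposet A) C :=
  @PosetFunctor _ (subposet A) C (fun x => F (val x)) restrict_mor
    restrict_mor_id restrict_mor_comp.

End Restrict.

Section Differential.
Context {d : Order.disp_t} {P : finPOrderType d} {A : abelianCat}.
Variables (rk : P -> nat) (c : P -> P -> int) (F : poset_functor P A).

(* F(x <= y), extended by 0 to pairs with x not below y. *)
Definition fmor0 (x y : P) : hom (F x) (F y) :=
  match @idP (x <= y) with ReflectT xy => fmor F xy | ReflectF _ => 0%R end.

Definition cochain_sum (k : nat) :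
  biproduct_of (fun x : {x : P | rk x == k} => F (val x)) := biproduct _.

Definition cochain_ob (k : nat) : A := bip_ob (cochain_sum k).

Definition cochain_d (k : nat) : hom (cochain_ob k) (cochain_ob k.+1) :=
  (\sum_(x : {x : P | rk x == k})
   \sum_(y : {y : P | rk y == k.+1} | covers (val x) (val y))
     bip_inj (cochain_sum k.+1) y
     \oc (fmor0 (val x) (val y) *~ c (val x) (val y))
     \oc bip_prj (cochain_sum k) x)%R.

End Differential.

Section ThinTheory.
Context {d : Order.disp_t} {P : finPOrderType d}.
Variables (rk : P -> nat) (rkP : is_rank rk).

Lemma covers_lt (x y : P) : covers x y -> x < y.
Proof. by case/andP. Qed.

Lemma rank_lt (x y : P) : x < y -> (rk x < rk y)%N.
Proof.
have [n] := ubnP #|[set w | x < w < y]|.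
elim: n x y => // n IHn x y lt_n xy.
have [cxy | ] := boolP (covers x y); first by rewrite (rkP cxy).
rewrite /covers xy /= => /forallPn [z]; rewrite negbK => /andP [xz zy].
have lt_card (a b : P) : x <= a -> b <= y -> z = a \/ z = b ->
    (#|[set w | (a < w < b)%O]| < n)%N.
  move=> xa yb zab; rewrite -ltnS (leq_trans _ lt_n) // ltnS.
  apply/proper_card/properP; split.
    apply/subsetP => w; rewrite !inE => /andP [aw wb].
    by rewrite (le_lt_trans xa aw) (lt_le_trans wb yb).
  by exists z; rewrite !inE ?xz ?zy //; case: zab => <-; rewrite ltxx ?andbF.
apply: (@ltn_trans (rk z)); apply: IHn => //; apply: lt_card => //.
- exact: ltW.
- by right.
- exact: ltW.
- by left.
Qed.

Lemma covers_rank (x y : P) : x < y -> rk y = (rk x).+1 -> covers x y.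
Proof.
move=> xy rxy; rewrite /covers xy; apply/forallP => z; apply/negP => /andP [xz zy].
by have := leq_ltn_trans (rank_lt xz) (rank_lt zy); rewrite rxy ltnn.
Qed.

End ThinTheory.

Section Diamond.
Context {d : Order.disp_t} {P : finPOrderType d}.
Variables (rk : P -> nat) (c : P -> P -> int).
Hypotheses (thinP : is_thin rk) (cP : is_balanced_coloring rk c).
Let rkP := thin_rank thinP.

Lemma diamond_sum (x z : P) : rk z = (rk x).+2 ->
  (\sum_(y : P | covers x y && covers y z) c x y * c y z = 0)%R.
Proof.
move=> rxz.
pose Y := [set y | covers x y && covers y z].
rewrite (eq_bigl (fun y => y \in Y)) => [|y]; last by rewrite inE.
have [-> | [y0]] := set_0Vmem Y; first by rewrite big_set0.
rewrite inE => /andP [xy0 y0z].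
have lxz : x < z by rewrite (lt_trans (covers_lt xy0) (covers_lt y0z)).
have YE y : (y \in Y) = (x < y < z).
  rewrite inE; apply/andP/andP => [[/covers_lt -> /covers_lt ->] // | [xy yz]].
  have rxy := rank_lt rkP xy; have ryz := rank_lt rkP yz.
  have ry : rk y = (rk x).+1.
    by apply/eqP; rewrite eqn_leq rxy andbT -ltnS -rxz.
  by split; apply: (covers_rank rkP) => //; rewrite ry.
have cardY : #|Y| = 2.
  have := thin_diamond thinP (ltW lxz) rxz.
  have -> : interval x z = x |: (z |: Y).
    apply/setP => y; rewrite in_set !in_setU1 YE.
    have [-> | nyx] := eqVneq y x; first by rewrite lexx ltW.
    have [-> | nyz] := eqVneq y z; first by rewrite lexx ltW.
    by rewrite !lt_neqAle (eq_sym x) nyx nyz.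
  rewrite cardsU1 cardsU1 !in_setU1 !YE !ltxx andbF.
  by rewrite (lt_eqF lxz) /= => [[]].
have := coloring_odd cP (ltW lxz) rxz.
set E : {set P * P} := finset _.
have -> : E = [set (x, y) | y in [set y in Y | c x y == (-1)%R]]
          :|: [set (y, z) | y in [set y in Y | c y z == (-1)%R]].
  apply/setP => -[a b]; rewrite !inE /=.
  apply/and4P/orP => [[/andP [xa az] /andP [xb bz] ab cab] | ].
    have lab := covers_lt ab.
    have [xEa | nxa] := eqVneq x a.
      have nbz : b != z.
        apply/eqP => bE; have := rkP ab; rewrite -xEa bE rxz => /eqP.
        by rewrite eqSS (gtn_eqF (ltnSn _)).
      left; apply/imsetP; exists b; last by rewrite xEa.
      by rewrite inE YE {1}xEa lab lt_neqAle nbz bz xEa cab.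
    have lxa : x < a by rewrite lt_neqAle nxa.
    have bEz : b = z.
      apply/eqP; apply: contraT => nbz.
      have lbz : b < z by rewrite lt_neqAle nbz.
      have := leq_ltn_trans (leq_ltn_trans (rank_lt rkP lxa) (rank_lt rkP lab) : (_ < _)%N) (rank_lt rkP lbz).
      by rewrite rxz ltnn.
    right; apply/imsetP; exists a; last by rewrite bEz.
    by rewrite inE YE lxa -bEz lab cab.
  case=> /imsetP [y]; rewrite inE YE => /andP [/andP [xy yz] cy] [-> ->].
    split; rewrite ?lexx ?(ltW xy) ?(ltW yz) ?(ltW lxz) //.
    by have: y \in Y; [rewrite YE xy | rewrite inE => /andP []].
  split; rewrite ?lexx ?(ltW xy) ?(ltW yz) ?(ltW lxz) //.
  by have: y \in Y; [rewrite YE xy | rewrite inE => /andP []].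
rewrite cardsU (_ : _ :&: _ = set0) ?cards0 ?subn0; last first.
  apply/setP => -[a b]; rewrite !inE; apply/negP => /andP [].
  move=> /imsetP [y _ [-> _]] /imsetP [y' + [xE _]].
  by rewrite -xE inE YE ltxx.
rewrite !card_imset => [|u v [] //|u v [] //].
have signY y : y \in Y ->
    (c x y = 1%R \/ c x y = (-1)%R) /\ (c y z = 1%R \/ c y z = (-1)%R).
  by rewrite inE => /andP [xy yz]; split; apply: (coloring_sign cP).
have /eqP/cards2P [y1 [y2 [n12 defY]]] := cardY.
have card_col (p : pred P) : #|[set y in Y | p y]| = (p y1 + p y2)%N.
  rewrite -sum1_card (eq_bigl (fun y => (y \in Y) && p y)) => [|y]; last by rewrite inE.
  rewrite big_mkcondr defY big_setU1 ?inE //= big_set1.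
  by case: (p y1); case: (p y2).
rewrite !card_col defY big_setU1 ?inE //= big_set1.
have [] := signY y1; first by rewrite defY !inE eqxx.
have [] := signY y2; first by rewrite defY !inE eqxx orbT.
by move=> [->|->] [->|->] [->|->] [->|->].
Qed.

End Diamond.

Section SubThin.
Context {d : Order.disp_t} {P : finPOrderType d}.
Variables (rk : P -> nat) (c : P -> P -> int).
Variables (A : {set P}) (convA : order_convex A).

Lemma sub_covers (x y : subposet A) : covers x y = covers (val x) (val y).
Proof.
rewrite /covers sub_lt; have [xy /= | //] := boolP (val x < val y).
apply/forallP/forallP => [H z | H z]; last by rewrite !sub_lt.
apply/negP => /andP [xz zy].
have zA : z \in A by apply: (convA (ltW xz) (ltW zy)); apply: valP.
by have := H (Sub z zA); rewrite !sub_lt SubK xz zy.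
Qed.

Lemma sub_is_thin :
  is_thin rk -> is_thin (fun x : subposet A => rk (val x)).
Proof.
case=> rkP diaP; split=> [x y | x y]; first by rewrite sub_covers => /rkP.
rewrite sub_le => xy rxy; rewrite -(diaP _ _ xy rxy) -(card_imset _ val_inj).
apply: eq_card => z; rewrite inE; apply/imsetP/andP.
  by case=> w; rewrite inE !sub_le => /andP [? ?] ->.
move=> [xz zy]; have zA : z \in A by apply: (convA xz zy); apply: valP.
by exists (Sub z zA); rewrite ?SubK // inE !sub_le SubK xz zy.
Qed.

Lemma sub_is_balanced : is_balanced_coloring rk c ->
  is_balanced_coloring (fun x : subposet A => rk (val x))
    (fun x y => c (val x) (val y)).
Proof.
case=> signP oddP; split=> [x y | x y]; first by rewrite sub_covers => /signP.
rewrite sub_le => xy rxy; have oddxy := oddP _ _ xy rxy.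
pose f (e : subposet A * subposet A) := (val e.1, val e.2).
have f_inj : injective f by move=> [? ?] [? ?] [/val_inj -> /val_inj ->].
rewrite -(card_imset _ f_inj); apply: etrans oddxy; congr odd; apply: eq_card => -[a b].
rewrite [RHS]inE; apply/imsetP/and4P.
  by case=> -[u v]; rewrite !inE /= !sub_le sub_covers => /and4P [? ? ? ?] [-> ->];
    split.
rewrite !inE => -[/andP [xa ay] /andP [xb by_] ab cab].
have aA : a \in A by apply: (convA xa ay); apply: valP.
have bA : b \in A by apply: (convA xb by_); apply: valP.
exists (Sub a aA, Sub b bA); last by [].
by rewrite !inE /= !sub_le sub_covers /= xa ay xb by_ ab cab.
Qed.

End SubThin.

Section PreadditiveTheory.
Context {C : preaddCat}.

Lemma comp0c (a b c : C) (f : hom a b) : (0 : hom b c) \oc f = 0%R.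
Proof. by apply: (@addrI _ (0%R \oc f)); rewrite -compDl !addr0. Qed.

Lemma compc0 (a b c : C) (g : hom b c) : g \oc (0 : hom a b) = 0%R.
Proof. by apply: (@addrI _ (g \oc 0%R)); rewrite -compDr !addr0. Qed.

Lemma comp_suml (a b c : C) (I : Type) (r : seq I) (Q : pred I)
    (g : I -> hom b c) (f : hom a b) :
  ((\sum_(i <- r | Q i) g i) \oc f = \sum_(i <- r | Q i) g i \oc f)%R.
Proof.
by apply: (big_morph (fun g => g \oc f)) => [x y|]; rewrite ?compDl ?comp0c.
Qed.

Lemma comp_sumr (a b c : C) (I : Type) (r : seq I) (Q : pred I)
    (g : hom b c) (f : I -> hom a b) :
  (g \oc (\sum_(i <- r | Q i) f i) = \sum_(i <- r | Q i) g \oc f i)%R.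
Proof.
by apply: (big_morph (comp g)) => [x y|]; rewrite ?compDr ?compc0.
Qed.

Lemma compNc (a b c : C) (g : hom b c) (f : hom a b) :
  (- g)%R \oc f = (- (g \oc f))%R.
Proof. by apply: (@addIr _ (g \oc f)); rewrite -compDl !addNr comp0c. Qed.

Lemma compcN (a b c : C) (g : hom b c) (f : hom a b) :
  g \oc (- f)%R = (- (g \oc f))%R.
Proof. by apply: (@addIr _ (g \oc f)); rewrite -compDr !addNr compc0. Qed.

Lemma compMzl (a b c : C) (g : hom b c) (f : hom a b) (n : int) :
  ((g *~ n) \oc f = (g \oc f) *~ n)%R.
Proof.
have compMn (m : nat) : ((g *+ m) \oc f = (g \oc f) *+ m)%R.
  by elim: m => [|m IHm]; rewrite ?mulr0n ?comp0c // !mulrS compDl IHm.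
by case: n => m; rewrite ?NegzE ?mulrNz -?pmulrn ?compNc compMn.
Qed.

Lemma compMzr (a b c : C) (g : hom b c) (f : hom a b) (n : int) :
  (g \oc (f *~ n) = (g \oc f) *~ n)%R.
Proof.
have compMn (m : nat) : (g \oc (f *+ m) = (g \oc f) *+ m)%R.
  by elim: m => [|m IHm]; rewrite ?mulr0n ?compc0 // !mulrS compDr IHm.
by case: n => m; rewrite ?NegzE ?mulrNz -?pmulrn ?compcN compMn.
Qed.

End PreadditiveTheory.

Section Complex.
Context {d : Order.disp_t} {P : finPOrderType d} {A : abelianCat}.
Variables (rk : P -> nat) (c : P -> P -> int).
Variables (thinP : is_thin rk) (cP : is_balanced_coloring rk c).
Variable F : poset_functor P A.

Lemma fmor0_comp (x y z : P) : x <= y -> y <= z ->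
  fmor0 F y z \oc fmor0 F x y = fmor0 F x z.
Proof.
move=> xy yz; rewrite /fmor0.
case: {-}_ / idP => [xy'|//]; case: {-}_ / idP => [yz'|//].
case: {-}_ / idP => [xz|]; last by rewrite (le_trans xy yz).
by rewrite -fmor_comp; congr fmor; apply: bool_irrelevance.
Qed.

Lemma cochain_dd (k : nat) :
  cochain_d rk c F k.+1 \oc cochain_d rk c F k = 0%R.
Proof.
rewrite /cochain_d comp_sumr; apply: big1 => x _.
rewrite comp_sumr.
set B0 := cochain_sum rk F k; set B1 := cochain_sum rk F k.+1.
set B2 := cochain_sum rk F k.+2.
transitivity (\sum_(y : {y : P | rk y == k.+1} | covers (val x) (val y))
  \sum_(z : {z : P | rk z == k.+2} | covers (val y) (val z))
   (bip_inj B2 z \oc fmor0 F (val x) (val z) \oc bip_prj B0 x)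
     *~ (c (val x) (val y) * c (val y) (val z)))%R.
  apply: eq_bigr => y xy; rewrite comp_suml (bigD1 y) //= [X in (_ + X)%R]big1; last first.
    move=> y' ny; rewrite comp_suml big1 // => z _.
    by rewrite -!compA (compA (bip_prj B1 y')) (bip_prj_inj0 B1) 1?eq_sym //
               comp0c !compc0.
  rewrite addr0 comp_suml; apply: eq_bigr => z yz.
  rewrite -!compA (compA (bip_prj B1 y)) (bip_prj_inj B1) comp1c.
  rewrite (compA (fmor0 F _ _ *~ _)%R) compMzl compMzr.
  by rewrite fmor0_comp ?coversW // -mulrzA !compMzl !compMzr.
rewrite (exchange_big_dep xpredT) //=; apply: big1 => z _.
rewrite -mulrz_sumr.
set S := (X in (_ *~ X)%R); suff -> : S = 0%R by rewrite mulr0z.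
have rxz : rk (val z) = (rk (val x)).+2.
  by rewrite (eqP (valP z)) (eqP (valP x)).
rewrite -(diamond_sum thinP cP rxz) /S.
rewrite [RHS](reindex_omap (val : {y : P | rk y == k.+1} -> P) insub) /=; last first.
  move=> y /andP [xy _]; have ry : rk y == k.+1.
    by rewrite (thin_rank thinP xy) (eqP (valP x)).
  by rewrite (insubT (fun y => rk y == k.+1) ry).
by apply: eq_bigl => y; rewrite valK eqxx andbT.
Qed.

Definition poset_complex : cochain_complex A :=
  CochainComplex cochain_dd.

End Complex.

Section Matching.
Context {T : finType}.
Variables (D : rel T) (M : {set T * T}).

Definition incident (v : T) (e : T * T) : bool := (v == e.1) || (v == e.2).

Definition is_matching : Prop :=
  (forall e, e \in M -> D e.1 e.2) /\
  (forall e e' v, e \in M -> e' \in M -> incident v e -> incident v e' -> e = e').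

Definition complete_matching : Prop :=
  forall v, exists2 e, e \in M & incident v e.

Definition reverse_matching : rel T := fun u v =>
  (D u v && ((u, v) \notin M)) || (D v u && ((v, u) \in M)).

Definition acyclic_matching : Prop :=
  forall s : seq T, s != [::] -> ~~ ucycleb reverse_matching s.

End Matching.

(* Main.v *)
(* Let B be the biproduct of all the F(x), D the total differential and e the
   idempotent of B projecting onto the summands in I.  Let h0 be the map which
   inverts the matched components of D.  Acyclicity says that
   e - (D_I h0 + h0 D_I), where D_I = e D e, is strictly triangular for a
   suitable ranking of I, hence nilpotent; a geometric series then corrects h0
   to a contraction h of (e B, D_I).  As I is an upper or lower ideal,
   phi = 1 - D h - h D is an idempotent chain endomorphism of B, homotopic to
   the identity, and composing it with the projection onto and the inclusion of
   the summands outside I gives mutually inverse homotopy equivalences. *)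
From HB Require Import structures.
From mathcomp Require Import all_boot all_order all_algebra.
Require Import Defs.

Set Implicit Arguments.
Unset Strict Implicit.
Unset Printing Implicit Defensive.

Import Order.TTheory GRing.Theory.
Local Open Scope ring_scope.
Local Open Scope cat_scope.

(** * Homology at one spot of a complex and its invariance under homotopy *)

Section Homology.
Context {A : abelianCat}.

(** A relation rather than a chosen object, so that degree 0, where cohomology is a bare kernel, and
    positive degrees are treated alike. *)
Definition is_homology (a b c : A) (f : hom a b) (g : hom b c) (H : A) : Prop :=
  exists (Z : A) (z : hom Z b) (l : hom a Z) (p : hom Z H),
    [/\ is_kernel g z, z \oc l = f & is_cokernel l p].

Lemma kernel_mono (a b k : A) (f : hom a b) (z : hom k a) :
  is_kernel f z -> is_mono z.
Proof.
case=> fz univ x u v zuv.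
have [|w [_ wuniq]] := univ x (z \oc u); first by rewrite compA fz comp0c.
by rewrite -(wuniq u) // -(wuniq v).
Qed.

Lemma cokernel_epi (a b k : A) (f : hom a b) (p : hom b k) :
  is_cokernel f p -> is_epi p.
Proof.
case=> pf univ x u v upv.
have [|w [_ wuniq]] := univ x (u \oc p); first by rewrite -compA pf compc0.
by rewrite -(wuniq u) // -(wuniq v).
Qed.

Lemma homology_map (a b c a' b' c' : A) (f : hom a b) (g : hom b c)
    (f' : hom a' b') (g' : hom b' c') (Z : A) (z : hom Z b) (l : hom a Z)
    (H : A) (p : hom Z H) (Z' : A) (z' : hom Z' b') (l' : hom a' Z')
    (H' : A) (p' : hom Z' H')
    (u : hom b b') (ua : hom a a') (uc : hom c c') :
    is_kernel g z -> z \oc l = f -> is_cokernel l p ->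
    is_kernel g' z' -> z' \oc l' = f' -> is_cokernel l' p' ->
    u \oc f = f' \oc ua -> g' \oc u = uc \oc g ->
  exists (w : hom Z Z') (r : hom H H'), z' \oc w = u \oc z /\ r \oc p = p' \oc w.
Proof.
move=> kz zl cp kz' zl' cp' uf gu.
have [|w [zw _]] := kz'.2 _ (u \oc z).
  by rewrite compA gu -compA kz.1 compc0.
have wl : w \oc l = l' \oc ua.
  by apply: (kernel_mono kz'); rewrite !compA zw zl' -compA zl.
have [|r [rp _]] := cp.2 _ (p' \oc w).
  by rewrite -compA wl compA cp'.1 comp0c.
by exists w, r.
Qed.

(** On the kernel [z] the term [t \oc g] vanishes, so [w] differs from the identity by a map that
    factors through [l], and [p] kills it. *)
Lemma homology_homotopic_id (a b c : A) (f : hom a b) (g : hom b c)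
    (Z : A) (z : hom Z b) (l : hom a Z) (H : A) (p : hom Z H)
    (w : hom Z Z) (r : hom H H) (s : hom b a) (t : hom c b) :
    is_kernel g z -> z \oc l = f -> is_cokernel l p ->
    z \oc w = (idc b - f \oc s - t \oc g) \oc z -> r \oc p = p \oc w ->
  r = idc H.
Proof.
move=> kz zl cp zw rp; apply: (cokernel_epi cp); rewrite rp comp1c.
have -> : w = idc Z - l \oc s \oc z.
  apply: (kernel_mono kz); rewrite zw !compDl !compDr !compNc !compcN comp1c.
  by rewrite -!compA kz.1 compc0 oppr0 addr0 compc1 -zl !compA.
by rewrite compDr compcN !compA cp.1 !comp0c oppr0 addr0 compc1.
Qed.

Lemma homology_isomorphic (a b c a' b' c' : A) (f : hom a b) (g : hom b c)
    (f' : hom a' b') (g' : hom b' c') (H H' : A)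
    (u : hom b b') (ua : hom a a') (uc : hom c c')
    (v : hom b' b) (va : hom a' a) (vc : hom c' c)
    (s : hom b a) (t : hom c b) (s' : hom b' a') (t' : hom c' b') :
    is_homology f g H -> is_homology f' g' H' ->
    u \oc f = f' \oc ua -> g' \oc u = uc \oc g ->
    v \oc f' = f \oc va -> g \oc v = vc \oc g' ->
    v \oc u = idc b - f \oc s - t \oc g ->
    u \oc v = idc b' - f' \oc s' - t' \oc g' ->
  isomorphic H H'.
Proof.
move=> [Z [z [l [p [kz zl cp]]]]] [Z' [z' [l' [p' [kz' zl' cp']]]]].
move=> uf gu vf gv vu uv.
have [w [r [zw rp]]] := homology_map kz zl cp kz' zl' cp' uf gu.
have [w' [r' [zw' rp']]] := homology_map kz' zl' cp' kz zl cp vf gv.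
exists r, r'; split.
  apply: (homology_homotopic_id (w := w' \oc w) (s := s) (t := t) kz zl cp).
    by rewrite -vu compA zw' -!compA zw.
  by rewrite -compA rp !compA rp'.
apply: (homology_homotopic_id (w := w \oc w') (s := s') (t := t') kz' zl' cp').
  by rewrite -uv compA zw -!compA zw'.
by rewrite -compA rp' !compA rp.
Qed.

(* In degree 0 the incoming map is the zero endomorphism of [X 0]. *)
Definition cx_in (X : cochain_complex A) (k : nat) : hom (X k.-1) (X k) :=
  if k is k'.+1 then cx_d X k' else 0.

Lemma cohomologyP (X : cochain_complex A) (k : nat) :
  is_homology (cx_in X k) (cx_d X k) (cohomology X k).
Proof.
case: k => [|k] /=.
  (* In degree 0 the incoming map is zero, and an identity is a cokernel of a zero map. *)
  exists (ker_ob (kernel (cx_d X 0))), (ker_map (kernel (cx_d X 0))), 0, (idc _).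
  split; [exact: ker_mapP | exact: compc0 | split; first exact: compc0].
  move=> x u _; exists u; split; first exact: compc1.
  by move=> v <-; rewrite compc1.
exists (ker_ob (kernel (cx_d X k.+1))), (ker_map (kernel (cx_d X k.+1))).
exists (ker_lift (cx_dd X k)), (coker_map (cokernel (ker_lift (cx_dd X k)))).
by split; [exact: ker_mapP | exact: ker_liftE | exact: coker_mapP].
Qed.

End Homology.

(** * Contractions and perturbation in an abstract ring *)

Section RingLemmas.
Context {R : pzRingType}.
Implicit Types D d e h q : R.

(** With [x = e - d * h - h * d], both [d] and [e] commute with [x], and
    [d * h + h * d = e * (1 - x)]. The geometric series inverts [1 - x] and commutes with [d], so
    multiplying [h] by it leaves exactly [e]. *)
Lemma nilpotent_contraction d e h n :
    d * d = 0 -> e * d = d -> d * e = d -> e * e = e -> e * h = h -> h * e = h ->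
    (e - d * h - h * d) ^+ n = 0 ->
  let k := h * \sum_(i < n) (e - d * h - h * d) ^+ i in
  [/\ e * k = k, k * e = k & d * k + k * d = e].
Proof.
move=> dd ed de ee eh he; set x := e - _ - _ => xn k.
pose S := \sum_(i < n) x ^+ i; rewrite -/S in k *.
have commS y : GRing.comm y x -> GRing.comm y S.
  by move=> yx; apply: commr_sum => i _; apply: commrX.
have ex : GRing.comm e x.
  by rewrite /GRing.comm /x !mulrBl !mulrBr !mulrA ed eh -!mulrA he de.
have dx : GRing.comm d x.
  rewrite /GRing.comm /x !mulrBl !mulrBr ed de !mulrA dd mul0r subr0.
  by rewrite -!mulrA dd mulr0 subr0.
have xS : (1 - x) * S = 1.
  have := subrX1 x n; rewrite xn sub0r => /(congr1 -%R).
  by rewrite opprK -mulNr opprB => <-.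
rewrite /k; split; first by rewrite mulrA eh.
  by rewrite -mulrA -(commS _ ex) mulrA he.
rewrite -mulrA -(commS _ dx) !mulrA -mulrDl.
have -> : d * h + h * d = e * (1 - x).
  by rewrite mulrBr mulr1 /x !mulrBr ee !mulrA ed eh -(addrA e) -opprD subKr.
by rewrite -mulrA xS mulr1.
Qed.

(* The identities making [q * phi] and [phi * q] mutually inverse homotopy
   equivalences between [(R, D)] and [(q R q, q D q)]. *)
Lemma contraction_perturbation D e h q phi :
    q = 1 - e -> phi = 1 - D * h - h * D ->
    D * D = 0 -> e * e = e -> D * e = e * D * e \/ e * D = e * D * e ->
    e * h = h -> h * e = h -> e * D * e * h + h * (e * D * e) = e ->
  [/\ phi * q * phi = phi, q * phi * phi * q = q,
      q * D * q * phi = q * phi * D & phi * q * D * q = D * phi * q].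
Proof.
move=> qE phiD0 DD ee cases eh he ctr.
have phiD : phi * D = D * phi.
  rewrite phiD0 !mulrBl !mulrBr mul1r mulr1 -[h * D * D]mulrA DD mulr0 subr0.
  by rewrite [D * (D * h)]mulrA DD mul0r subr0 mulrA.
have qe : q * e = 0 by rewrite qE mulrBl mul1r ee subrr.
have eq0 : e * q = 0 by rewrite qE mulrBr mulr1 ee subrr.
have qq : q * q = q by rewrite {2}qE mulrBr mulr1 qe subr0.
have hq : h * q = 0 by rewrite qE mulrBr mulr1 he subrr.
have qh : q * h = 0 by rewrite qE mulrBl mul1r eh subrr.
(* The cases are mirror images. If the image of [e] is stable under [D], then [phi = q - h * D * q],
   so [q * phi = q] and [phi * q = phi]. In the second case the image of [q] is stable,
   [phi = q - q * D * h], so [q * phi = phi] and [phi * q = q]. *)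
case: cases => De.
  have qDe : q * D * e = 0 by rewrite -mulrA De !mulrA qe !mul0r.
  have phiE : phi = q - h * D * q.
    have hDe : h * D * e = h * (e * D * e) by rewrite -De mulrA.
    have Dh : D * h = e * D * e * h by rewrite -De -mulrA eh.
    by rewrite qE mulrBr mulr1 hDe -[X in 1 - X - _]ctr phiD0 Dh opprD opprB !addrA subrK.
  have qphi : q * phi = q by rewrite phiE mulrBr qq !mulrA qh !mul0r subr0.
  have phiq : phi * q = phi by rewrite phiE mulrBl qq -[_ * q * q]mulrA qq.
  have phi2 : phi * phi = phi by rewrite -{1}phiq -mulrA qphi phiq.
  have qDq : q * D * q = q * D by rewrite [X in _ * X = _]qE mulrBr mulr1 qDe subr0.
  split; first by rewrite phiq phi2.
  - by rewrite !qphi qq.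
  - by rewrite qDq -!mulrA phiD.
  - by rewrite phiq phiD.
have eDq : e * D * q = 0 by rewrite De -!mulrA eq0 !mulr0.
have phiE : phi = q - q * D * h.
  have eDh : e * (D * h) = e * D * e * h by rewrite -[e * D * e * h]mulrA eh mulrA.
  have hD : h * D = h * (e * D * e) by rewrite -De mulrA he.
  rewrite -mulrA qE mulrBl mul1r eDh -[X in 1 - X - _]ctr phiD0 hD.
  by rewrite opprD opprB (addrC (- (e * D * e * h))) [1 + (_ + _)]addrA subrKA addrAC.
have phiq : phi * q = q by rewrite phiE mulrBl qq -!mulrA hq !mulr0 subr0.
have qphi : q * phi = phi by rewrite phiE mulrBr qq !mulrA qq.
have phi2 : phi * phi = phi by rewrite -{2}qphi mulrA phiq qphi.
have qDq : q * D * q = D * q.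
  by rewrite -mulrA [X in X * (D * q)]qE mulrBl mul1r mulrA eDq subr0.
split; first by rewrite phiq qphi.
- by rewrite qphi phi2 phiq.
- by rewrite -(mulrA (q * D)) -(mulrA q phi) phiD qphi mulrA.
- by rewrite phiq qDq -mulrA phiq.
Qed.

End RingLemmas.

(** * The endomorphism ring of an object *)

Section EndomorphismRing.
Context {C : preaddCat}.
Variable B : C.

(** A name of its own to carry the ring structure; it unfolds to [hom B B], so ring identities are
    identities between composites. *)
Definition endo : Type := hom B B.

HB.instance Definition _ := GRing.Zmodule.on endo.

Definition endo_mul (f g : endo) : endo := f \oc g.

Lemma endo_mulA : associative endo_mul.
Proof. by move=> f g h; apply: compA. Qed.

Lemma endo_mul1r : left_id (idc B : endo) endo_mul.
Proof. by move=> f; apply: comp1c. Qed.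

Lemma endo_mulr1 : right_id (idc B : endo) endo_mul.
Proof. by move=> f; apply: compc1. Qed.

Lemma endo_mulDl : left_distributive endo_mul +%R.
Proof. by move=> f g h; apply: compDl. Qed.

Lemma endo_mulDr : right_distributive endo_mul +%R.
Proof. by move=> f g h; apply: compDr. Qed.

HB.instance Definition _ := GRing.Zmodule_isPzRing.Build endo
  endo_mulA endo_mul1r endo_mulr1 endo_mulDl endo_mulDr.

End EndomorphismRing.

(** * Two complexes cut out of one object [B] by degree idempotents [e k] *)

Section GradedRetract.
Context {A : abelianCat}.
Variables (X Y : cochain_complex A) (B : A).
Variables (iX : forall k, hom (X k) B) (pX : forall k, hom B (X k)).
Variables (iY : forall k, hom (Y k) B) (pY : forall k, hom B (Y k)).
Variables (D h q phi : hom B B) (e : nat -> hom B B).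
Hypotheses (pXK : forall k, pX k \oc iX k = idc (X k))
  (pYK : forall k, pY k \oc iY k = idc (Y k))
  (iXK : forall k, iX k \oc pX k = e k)
  (iYK : forall k, iY k \oc pY k = e k \oc q)
  (qq : q \oc q = q) (qe : forall k, q \oc e k = e k \oc q)
  (dX : forall k, cx_d X k = pX k.+1 \oc D \oc iX k)
  (dY : forall k, cx_d Y k = pY k.+1 \oc D \oc iY k)
  (De : forall k, e k.+1 \oc D \oc e k = D \oc e k)
  (he0 : h \oc e 0 = 0)
  (he : forall k, e k \oc h \oc e k.+1 = h \oc e k.+1)
  (phiE : phi = idc B - D \oc h - h \oc D)
  (phi_qphi : phi \oc q \oc phi = phi)
  (q_phi_phi_q : q \oc phi \oc phi \oc q = q)
  (q_chain : q \oc D \oc q \oc phi = q \oc phi \oc D)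
  (chain_q : phi \oc q \oc D \oc q = D \oc phi \oc q).

Let eX k : e k \oc iX k = iX k.
Proof. by rewrite -iXK -compA pXK compc1. Qed.

Let ee k : e k \oc e k = e k.
Proof. by rewrite -{2}iXK compA eX iXK. Qed.

Let eY k : e k \oc iY k = iY k.
Proof.
rewrite -[in LHS](compc1 (iY k)) -pYK (compA (iY k)) iYK !compA ee.
by rewrite -iYK -compA pYK compc1.
Qed.

Let qY k : q \oc iY k = iY k.
Proof.
by rewrite -[in LHS](compc1 (iY k)) -pYK (compA (iY k)) iYK !compA qe -(compA (e k)) qq
  -iYK -compA pYK compc1.
Qed.

Let Yq k : pY k \oc q = pY k.
Proof.
rewrite -[in LHS](comp1c (pY k)) -pYK -(compA (pY k)) iYK -!compA qq.
by rewrite -iYK compA pYK comp1c.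
Qed.

(** Degree bookkeeping: [D] raises the degree by one and [h] lowers it, so both of their composites
    preserve it. *)
Let shift_comp (a b k : hom B B) (f g : hom B B) :
  a \oc f \oc b = f \oc b -> b \oc g \oc k = g \oc k ->
  a \oc (f \oc g) \oc k = f \oc g \oc k.
Proof.
move=> fE gE.
by rewrite -!compA -gE -!compA; have := congr1 (comp^~ (g \oc k)) fE; rewrite -!compA.
Qed.

Let Dhe k : e k \oc (D \oc h) \oc e k = D \oc h \oc e k.
Proof.
(* No degree lies below 0, so [he0] takes the place of [he] there. *)
case: k => [|k]; first by rewrite -compA -(compA D) he0 !compc0.
exact: shift_comp (De k) (he k).
Qed.

Let phie k : e k \oc phi \oc e k = phi \oc e k.
Proof.
rewrite phiE !(compDl, compDr, compNc, compcN) compc1 comp1c ee Dhe.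
by rewrite (shift_comp (he k) (De k)).
Qed.

Let DiX k : e k.+1 \oc D \oc iX k = D \oc iX k.
Proof. by rewrite -eX !compA De. Qed.

Let DiY k : e k.+1 \oc D \oc iY k = D \oc iY k.
Proof. by rewrite -eY !compA De. Qed.

Let phiiX k : e k \oc phi \oc iX k = phi \oc iX k.
Proof. by rewrite -eX !compA phie. Qed.

Let phiiY k : e k \oc phi \oc iY k = phi \oc iY k.
Proof. by rewrite -eY !compA phie. Qed.

Let u k : hom (X k) (Y k) := pY k \oc phi \oc iX k.
Let v k : hom (Y k) (X k) := pX k \oc phi \oc iY k.

Let u_chain k : u k.+1 \oc cx_d X k = cx_d Y k \oc u k.
Proof.
rewrite dX dY /u -!compA (compA (iX _)) iXK (compA (e _)) DiX.
rewrite (compA (iY _)) iYK -qe -(compA q) (compA (e k)) phiiX.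
rewrite -[in LHS]Yq -[in RHS]Yq -!compA; congr comp.
by rewrite !compA q_chain.
Qed.

Let v_chain k : v k.+1 \oc cx_d Y k = cx_d X k \oc v k.
Proof.
rewrite dX dY /v -!compA (compA (iX _)) iXK (compA (e _)) phiiY.
rewrite (compA (iY _)) iYK -qe -(compA q) (compA (e k.+1)) DiY.
rewrite -[in LHS]qY -[in RHS]qY; congr comp.
by rewrite !compA chain_q.
Qed.

(** On [Y] the composite is strictly the identity, because [q \oc phi \oc phi \oc q = q]; the
    homotopy on this side is zero. *)
Let uvK k : u k \oc v k = idc (Y k).
Proof.
rewrite /u /v -!compA (compA (iX _)) iXK (compA (e _)) phiiY.
have := congr1 (fun f => pY k \oc f \oc iY k) q_phi_phi_q.
by rewrite -!compA qY !compA Yq pYK.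
Qed.

(** The composite is the degree [k] part of [phi \oc q \oc phi], which is [phi]; the homotopy
    consists of the components of [h]. *)
Let vuE k : v k \oc u k = idc (X k)
  - cx_in X k \oc (pX k.-1 \oc h \oc iX k)
  - (pX k \oc h \oc iX k.+1) \oc cx_d X k.
Proof.
rewrite /u /v -!compA (compA (iY _)) iYK -qe -(compA q) (compA (e _)) phiiX.
rewrite (compA q) (compA phi) (compA phi q) phi_qphi phiE.
rewrite !(compDl, compDr, compNc, compcN) comp1c pXK.
congr (_ - _ - _); last first.
  by rewrite dX -!compA (compA (iX _)) iXK (compA (e _)) DiX.
case: k => [|k] /=; first by rewrite comp0c -eX !compA -(compA _ h) he0 !(compc0, comp0c).
rewrite dX -!compA (compA (iX _)) iXK -eX; do 2 congr comp.
by rewrite !compA he.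
Qed.

Lemma graded_retract_cohomology k :
  isomorphic (cohomology X k) (cohomology Y k).
Proof.
have in_chain : u k \oc cx_in X k = cx_in Y k \oc u k.-1.
  by case: (k) => [|j] /=; rewrite ?u_chain // compc0 comp0c.
have in_chain' : v k \oc cx_in Y k = cx_in X k \oc v k.-1.
  by case: (k) => [|j] /=; rewrite ?v_chain // compc0 comp0c.
apply: (homology_isomorphic (cohomologyP X k) (cohomologyP Y k)
  in_chain (esym (u_chain k)) in_chain' (esym (v_chain k)) (vuE k)
  (s' := 0) (t' := 0)).
by rewrite uvK compc0 comp0c !subr0.
Qed.

End GradedRetract.

(** * Matrix calculus for endomorphisms of a biproduct *)

Section Entries.
Context {C : preaddCat} {P : finType} {X : P -> C}.
Variable BX : biproduct_of X.
Let B := bip_ob BX.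
Implicit Types (f g : hom B B) (x y z : P) (S T : {set P}) (R : rel P).

Definition entry f x y : hom (X x) (X y) := bip_prj BX y \oc f \oc bip_inj BX x.

Definition of_entries (m : forall x y, hom (X x) (X y)) : hom B B :=
  \sum_x \sum_y bip_inj BX y \oc m x y \oc bip_prj BX x.

(** One notion of zero pattern, read from source to target, serves for degree shifts, cover
    relations and triangularity. *)
Definition supported f R : Prop := forall x y, ~~ R x y -> entry f x y = 0.

Definition bip_idem S : hom B B := \sum_(x in S) bip_inj BX x \oc bip_prj BX x.

Lemma entryK f : of_entries (entry f) = f.
Proof.
rewrite -[RHS]compc1 -[RHS]comp1c -bip_inj_prj comp_sumr comp_sumr.
apply: eq_bigr => x _; rewrite comp_suml; apply: eq_bigr => y _.
by rewrite !compA.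
Qed.

Lemma entry_inj f g : (forall x y, entry f x y = entry g x y) -> f = g.
Proof.
move=> fg; rewrite -(entryK f) -(entryK g).
by apply: eq_bigr => x _; apply: eq_bigr => y _; rewrite fg.
Qed.

Lemma of_entriesK m x y : entry (of_entries m) x y = m x y.
Proof.
rewrite /entry /of_entries comp_sumr comp_suml (bigD1 x) //= [X in _ + X]big1.
  rewrite addr0 comp_sumr comp_suml (bigD1 y) //= big1 => [|z zy].
    by rewrite addr0 !compA bip_prj_inj comp1c -compA bip_prj_inj compc1.
  by rewrite !compA bip_prj_inj0 // !comp0c.
move=> z zx; rewrite comp_sumr comp_suml big1 // => w _.
by rewrite -!compA bip_prj_inj0 1?eq_sym // !compc0.
Qed.

Lemma entryB f g x y : entry (f - g) x y = entry f x y - entry g x y.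
Proof. by rewrite /entry compDr compDl compcN compNc. Qed.

Lemma entry_comp f g x z :
  entry (f \oc g) x z = \sum_y entry f y z \oc entry g x y.
Proof.
rewrite /entry -{1}(compc1 f) -bip_inj_prj !(comp_sumr, comp_suml).
by apply: eq_bigr => y _; rewrite !compA.
Qed.

Lemma entry0 x y : entry 0 x y = 0.
Proof. by rewrite /entry compc0 comp0c. Qed.

Lemma entry_id x y : x != y -> entry (idc B) x y = 0.
Proof. by move=> xy; rewrite /entry compc1 bip_prj_inj0. Qed.

Lemma bip_prj_idem S x :
  bip_prj BX x \oc bip_idem S = if x \in S then bip_prj BX x else 0.
Proof.
rewrite comp_sumr; case: ifPn => xS.
  rewrite (bigD1 x) //= compA bip_prj_inj comp1c big1 ?addr0 // => y /andP [_ yx].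
  by rewrite compA bip_prj_inj0 // comp0c.
rewrite big1 // => y yS; rewrite compA bip_prj_inj0 ?comp0c //.
by apply: contraNneq xS => <-.
Qed.

Lemma bip_idem_inj S x :
  bip_idem S \oc bip_inj BX x = if x \in S then bip_inj BX x else 0.
Proof.
rewrite comp_suml; case: ifPn => xS.
  rewrite (bigD1 x) //= -compA bip_prj_inj compc1 big1 ?addr0 // => y /andP [_ yx].
  by rewrite -compA bip_prj_inj0 1?eq_sym // compc0.
rewrite big1 // => y yS; rewrite -compA bip_prj_inj0 ?compc0 //.
by apply: contraNneq xS => ->.
Qed.

Lemma entry_idem_comp S f x y :
  entry (bip_idem S \oc f) x y = if y \in S then entry f x y else 0.
Proof.
by rewrite /entry compA bip_prj_idem; case: ifP => // _; rewrite !comp0c.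
Qed.

Lemma entry_comp_idem S f x y :
  entry (f \oc bip_idem S) x y = if x \in S then entry f x y else 0.
Proof.
by rewrite /entry -!compA bip_idem_inj; case: ifP => // _; rewrite !compc0.
Qed.

Lemma entry_idem S x y :
  entry (bip_idem S) x y = if x \in S then entry (idc B) x y else 0.
Proof. by rewrite -entry_comp_idem comp1c. Qed.

Lemma bip_idemI S T : bip_idem S \oc bip_idem T = bip_idem (S :&: T).
Proof.
apply: entry_inj => x y; rewrite entry_idem_comp !entry_idem inE.
have [<-|xy] := eqVneq x y; first by case: (x \in S); case: (x \in T).
by rewrite entry_id // !if_same.
Qed.

Lemma bip_idemC S : bip_idem (~: S) = idc B - bip_idem S.
Proof.
apply: (addIr (bip_idem S)); rewrite subrK -bip_inj_prj.
rewrite [RHS](bigID (mem S)) addrC /=; congr (_ + _).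
by apply: eq_bigl => x; rewrite inE.
Qed.

Lemma supported_comp R R' R'' f g :
    (forall x y z, R' x y -> R y z -> R'' x z) ->
    supported f R -> supported g R' -> supported (f \oc g) R''.
Proof.
move=> RR sf sg x z nR; rewrite entry_comp big1 // => y _.
have [/RR Ryz|/sg ->] := boolP (R' x y); last by rewrite compc0.
by rewrite sf ?comp0c //; apply: contra nR => /Ryz.
Qed.

Lemma idem_comp_supported S T f R :
    (forall x y, R x y -> x \in T -> y \in S) -> supported f R ->
  bip_idem S \oc f \oc bip_idem T = f \oc bip_idem T.
Proof.
move=> RST sf; apply: entry_inj => x y; rewrite !entry_comp_idem.
case: ifPn => // xT; rewrite entry_idem_comp; case: ifPn => // yS.
by rewrite sf //; apply: contra yS => /RST ->.
Qed.

Section SubBiproduct.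
Context {J : finType} {v : J -> P}.
Variables (v_inj : injective v) (BJ : biproduct_of (fun j => X (v j))).

(** The chosen biproduct of a subfamily has no given relation to [B]; this matrix and the next
    exhibit it as a retract. *)
Definition sub_bip_inj : hom (bip_ob BJ) B :=
  \sum_j bip_inj BX (v j) \oc bip_prj BJ j.

Definition sub_bip_prj : hom B (bip_ob BJ) :=
  \sum_j bip_inj BJ j \oc bip_prj BX (v j).

Lemma sub_bip_injK : sub_bip_prj \oc sub_bip_inj = idc (bip_ob BJ).
Proof.
rewrite -(bip_inj_prj BJ) comp_sumr; apply: eq_bigr => i _.
rewrite comp_suml (bigD1 i) //= -compA (compA (bip_prj BX _)) bip_prj_inj comp1c.
rewrite big1 ?addr0 // => j ji.
rewrite -compA (compA (bip_prj BX _)) bip_prj_inj0 ?comp0c ?compc0 //.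
by rewrite (inj_eq v_inj) eq_sym.
Qed.

Lemma sub_bip_prjK : sub_bip_inj \oc sub_bip_prj = bip_idem [set v j | j : J].
Proof.
rewrite /bip_idem big_imset /=; last by move=> i j _ _ /v_inj.
rewrite comp_suml; apply: eq_big => [j|i _]; first by rewrite inE.
rewrite comp_sumr (bigD1 i) //= -compA (compA (bip_prj BJ _)) bip_prj_inj comp1c.
rewrite big1 ?addr0 // => j ji.
by rewrite -compA (compA (bip_prj BJ _)) bip_prj_inj0 // comp0c compc0.
Qed.

End SubBiproduct.

Lemma sub_bip_block (J K : finType) (v : J -> P) (w : K -> P)
    (BJ : biproduct_of (fun j => X (v j))) (BK : biproduct_of (fun k => X (w k))) f :
  sub_bip_prj BK \oc f \oc sub_bip_inj BJ =
  \sum_j \sum_k bip_inj BK k \oc entry f (v j) (w k) \oc bip_prj BJ j.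
Proof.
rewrite comp_sumr; apply: eq_bigr => j _; rewrite !comp_suml.
by apply: eq_bigr => k _; rewrite !compA.
Qed.

End Entries.

(** Counting the vertices reachable from [x] gives [rho x]. Along an edge from [x] to [y] the
    reachable set loses at least [x], since a path from [y] back to [x] would close a cycle. *)
Lemma acyclic_rank (T : finType) (r : rel T) :
    (forall s, s != [::] -> ~~ ucycleb r s) ->
  exists rho : T -> nat, forall x y, r x y -> (rho y < rho x)%N.
Proof.
move=> acy; exists (fun x => #|connect r x|) => x y rxy.
apply/proper_card/properP; split.
  by apply/subsetP => z; apply: connect_trans; apply: connect1.
exists x; first exact: connect0.
(* Acyclicity speaks of cycles without repetition, so the path back is first shortened to a simple
   one. *)
apply/negP => /connectP [p /shortenP [q yq uq _] xE].
have := acy (y :: q) isT; rewrite /ucycleb uq andbT /= rcons_path yq /=.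
by rewrite -xE rxy.
Qed.

(** * The functor on comparable and incomparable pairs *)

Section FunctorEntry.
Context {d : Order.disp_t} {P : finPOrderType d} {A : abelianCat}.
Variable F : poset_functor P A.

Lemma fmor0E (x y : P) (xy : (x <= y)%O) : fmor0 F x y = fmor F xy.
Proof.
rewrite /fmor0; case: {-}_ / idP => [xy'|//].
by congr fmor; apply: bool_irrelevance.
Qed.

Lemma fmor0_out (x y : P) : ~~ (x <= y)%O -> fmor0 F x y = 0.
Proof. by rewrite /fmor0; case: {-}_ / idP => [xy /negP|//]. Qed.

End FunctorEntry.

(** * The total differential, and both cochain differentials as its blocks *)

Section TotalDifferential.
Context {d : Order.disp_t} {P : finPOrderType d} {A : abelianCat}.
Variables (rk : P -> nat) (c : P -> P -> int) (F : poset_functor P A).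
Hypotheses (thinP : is_thin rk) (balP : is_balanced_coloring rk c).

Definition total_sum : biproduct_of F := biproduct F.

Definition total_d : hom (bip_ob total_sum) (bip_ob total_sum) :=
  of_entries total_sum
    (fun x y => if covers x y then fmor0 F x y *~ c x y else 0).

Lemma total_dE x y : entry total_d x y =
  if covers x y then fmor0 F x y *~ c x y else 0.
Proof. exact: of_entriesK. Qed.

Lemma supported_total_d : supported total_d covers.
Proof. by move=> x y /negbTE nc; rewrite total_dE nc. Qed.

(** By functoriality every chain from [x] through [y] to [z] contributes a multiple of the same map
    [fmor0 F x z]; over a diamond the multiples cancel. *)
Lemma total_dd : total_d \oc total_d = 0.
Proof.
apply: entry_inj => x z; rewrite entry_comp entry0.
rewrite (eq_bigr (fun y => if covers x y && covers y z then
    fmor0 F x z *~ (c x y * c y z) else 0)); last first.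
  move=> y _; rewrite !total_dE.
  case: (boolP (covers x y)) => xy /=; last by rewrite compc0.
  case: ifP => yz; last by rewrite comp0c.
  by rewrite compMzl compMzr fmor0_comp ?coversW // -mulrzA.
rewrite -big_mkcond -mulrz_sumr.
have [rxz|rxz] := eqVneq (rk z) (rk x).+2.
  by rewrite (diamond_sum thinP balP rxz) mulr0z.
(* Two successive covers raise the rank by two, so the sum is empty for all other ranks. *)
rewrite big_pred0 ?mulr0z // => y; apply/negP => /andP [xy yz].
by rewrite (thin_rank thinP yz) (thin_rank thinP xy) eqxx in rxz.
Qed.

Definition rank_set (k : nat) : {set P} := [set x | rk x == k].

Definition rank_inj (k : nat) := sub_bip_inj total_sum (cochain_sum rk F k).
Definition rank_prj (k : nat) := sub_bip_prj total_sum (cochain_sum rk F k).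

Lemma rank_injK k : rank_prj k \oc rank_inj k = idc (cochain_ob rk F k).
Proof. by apply: sub_bip_injK; apply: val_inj. Qed.

Lemma rank_prjK k : rank_inj k \oc rank_prj k = bip_idem total_sum (rank_set k).
Proof.
rewrite [LHS]sub_bip_prjK; last exact: val_inj.
congr bip_idem; apply/setP => x; rewrite !inE.
apply/imsetP/idP => [[y _ ->]|kx]; first exact: (valP y).
by exists (Sub x kx).
Qed.

Lemma cochain_dE k :
  cochain_d rk c F k = rank_prj k.+1 \oc total_d \oc rank_inj k.
Proof.
rewrite /rank_prj /rank_inj sub_bip_block; apply: eq_bigr => x _.
rewrite big_mkcond; apply: eq_bigr => y _; rewrite total_dE.
by case: ifP => // _; rewrite compc0 comp0c.
Qed.

Variable Q : {set P}.
Hypothesis convQ : order_convex Q.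

Let subrk (x : subposet Q) := rk (val x).
Let subc (x y : subposet Q) := c (val x) (val y).

(** Retyping the biproduct shows its summands as members of the family [F], indexed through two
    nested subtypes. *)
Let res_sum (k : nat) :
    biproduct_of (fun x : {x : subposet Q | subrk x == k} => F (val (val x))) :=
  cochain_sum subrk (restrict F Q) k.

Definition res_inj (k : nat) := sub_bip_inj total_sum (res_sum k).
Definition res_prj (k : nat) := sub_bip_prj total_sum (res_sum k).

Let val2_inj k :
  injective (fun x : {x : subposet Q | subrk x == k} => val (val x)).
Proof. by move=> x y /val_inj/val_inj. Qed.

Lemma res_injK k : res_prj k \oc res_inj k = idc (cochain_ob subrk (restrict F Q) k).
Proof. exact: (sub_bip_injK total_sum (@val2_inj k) (res_sum k)). Qed.

Lemma res_prjK k :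
  res_inj k \oc res_prj k = bip_idem total_sum (rank_set k :&: Q).
Proof.
rewrite [LHS](sub_bip_prjK total_sum (@val2_inj k) (res_sum k)).
congr bip_idem; apply/setP => x; rewrite !inE.
apply/imsetP/andP => [[y _ ->]|[kx xQ]]; first by split; [apply: (valP y) | apply: valP].
by exists (Sub (Sub x xQ : subposet Q) kx).
Qed.

Lemma fmor0_restrict (x y : subposet Q) :
  fmor0 (restrict F Q) x y = fmor0 F (val x) (val y).
Proof.
case: (boolP (x <= y)%O) => xy; last by rewrite !fmor0_out // -sub_le.
have vxy : (val x <= val y)%O by rewrite -sub_le.
rewrite !fmor0E /= /restrict_mor; congr fmor; exact: bool_irrelevance.
Qed.

(** Convexity makes the covers of the subposet covers of [P], so the restricted differential is a
    block of the same [total_d]. *)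
Lemma res_cochain_dE k :
  cochain_d subrk subc (restrict F Q) k = res_prj k.+1 \oc total_d \oc res_inj k.
Proof.
rewrite [RHS]sub_bip_block; apply: eq_bigr => x _.
rewrite big_mkcond; apply: eq_bigr => y _; rewrite total_dE (sub_covers convQ).
rewrite fmor0_restrict.
by case: ifP => // _; rewrite compc0 comp0c.
Qed.

End TotalDifferential.

(** * Zero patterns under ring operations, and nilpotency *)

Section SupportedRing.
Context {C : preaddCat} {P : finType} {X : P -> C}.
Variable BX : biproduct_of X.
Implicit Types (f g : endo (bip_ob BX)) (R : rel P).

Lemma supportedB f g R : supported f R -> supported g R -> supported (f - g) R.
Proof. by move=> sf sg x y nR; rewrite entryB sf ?sg ?subr0. Qed.

Lemma supported1 R : reflexive R -> supported (idc (bip_ob BX)) R.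
Proof. by move=> Rxx x y nR; apply: entry_id; apply: contraNneq nR => ->. Qed.

Lemma supported_idem S R : reflexive R -> supported (bip_idem BX S) R.
Proof. by move=> Rxx x y nR; rewrite entry_idem (supported1 Rxx) ?if_same. Qed.

Lemma supported_sum R n (f : 'I_n -> endo (bip_ob BX)) :
  (forall i, supported (f i) R) -> supported (\sum_i f i) R.
Proof.
move=> sf x y nR; rewrite /entry comp_sumr comp_suml big1 // => i _.
exact: sf.
Qed.

Lemma supportedX f R n : reflexive R -> transitive R ->
  supported f R -> supported (f ^+ n) R.
Proof.
move=> Rxx Rtr sf; elim: n => [|n IHn]; first by rewrite expr0; apply: supported1.
rewrite exprS; apply: (supported_comp (R := R) (R' := R)) => // x y z.
exact: Rtr.
Qed.

(** Each factor lowers [rho] by at least one, so a nonzero entry of [f ^+ n] needs a drop of at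
    least [n]. *)
Lemma supported_nilpotent f (rho : P -> nat) :
  supported f (fun x y => rho y < rho x)%N -> exists n, f ^+ n = 0.
Proof.
move=> sf; have sX n : supported (f ^+ n) (fun x y => rho y + n <= rho x)%N.
  elim: n => [|n IHn].
    by rewrite expr0; apply: supported1 => x; rewrite addn0.
  rewrite exprS; apply: supported_comp sf IHn => x y z xy yz.
  by rewrite addnS (leq_trans _ xy) // ltn_add2r.
(* The sum of all values bounds each single one, so no drop is this large. *)
exists (\sum_x rho x).+1; apply: entry_inj => x y; rewrite entry0; apply: sX.
rewrite -ltnNge addnS ltnS (leq_trans _ (leq_addl _ _)) //.
by rewrite (bigD1 x) //= leq_addr.
Qed.

End SupportedRing.

(** * From a matching with a compatible ranking to a contraction *)

Section MatchingContraction.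
Context {disp : Order.disp_t} {P : finPOrderType disp} {A : abelianCat}.
Variables (rk : P -> nat) (c : P -> P -> int) (F : poset_functor P A).
Hypotheses (thinP : is_thin rk) (balP : is_balanced_coloring rk c).
Variables (I : {set P}) (m : rel P) (rho : P -> nat).
Hypotheses (m_in : forall x y, m x y -> (x \in I) && (y \in I))
  (m_covers : forall x y, m x y -> covers x y)
  (m_complete : forall x, x \in I -> exists y, m x y || m y x)
  (m_fun : forall x y z, m x y -> m x z -> y = z)
  (m_inj : forall x y z, m x z -> m y z -> x = y)
  (m_stop : forall x y z, m x y -> ~~ m y z)
  (m_iso : forall x y, m x y -> is_iso (fmor0 F x y))
  (rho_up : forall x y, x \in I -> y \in I -> covers x y -> ~~ m x y ->
     (rho y < rho x)%N)
  (rho_down : forall x y, m x y -> (rho x < rho y)%N).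

Let B := endo (bip_ob (total_sum F)).
Let e : B := bip_idem (total_sum F) I.
Let D : B := total_d c F.
Let dI : B := e * D * e.
Hypothesis idealI : D * e = e * D * e \/ e * D = e * D * e.

Let entry_dI x y : entry dI x y =
  if [&& x \in I, y \in I & covers x y] then fmor0 F x y *~ c x y else 0.
Proof.
rewrite [LHS]entry_comp_idem; case: (x \in I) => //=.
by rewrite [LHS]entry_idem_comp total_dE; case: (y \in I).
Qed.

(** Finite choice in each variable gathers the inverses into one family. A color is its own inverse,
    so it scales the inverse as well. *)
Let m_inverse : exists g : forall x y, hom (F y) (F x), forall x y, m x y ->
  g x y \oc (fmor0 F x y *~ c x y) = idc (F x) /\
  (fmor0 F x y *~ c x y) \oc g x y = idc (F y).
Proof.
apply: (fin_all_exists (P := fun x (g : forall y, hom (F y) (F x)) =>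
  forall y, m x y -> g y \oc (fmor0 F x y *~ c x y) = idc (F x) /\
    (fmor0 F x y *~ c x y) \oc g y = idc (F y))) => x.
apply: (fin_all_exists (P := fun y (g : hom (F y) (F x)) =>
  m x y -> g \oc (fmor0 F x y *~ c x y) = idc (F x) /\
    (fmor0 F x y *~ c x y) \oc g = idc (F y))) => y.
case: (boolP (m x y)) => mxy; last by exists 0.
have [g [gf fg]] := m_iso mxy; exists (g *~ c x y) => _.
rewrite !compMzl !compMzr gf fg -!mulrzA.
by have [->|->] := coloring_sign balP (m_covers mxy).
Qed.

Lemma matching_contraction : exists h : B,
  [/\ e * h = h, h * e = h, dI * h + h * dI = e &
      supported h (fun x y => rk x == (rk y).+1)].
Proof.
have [g gP] := m_inverse.
pose h0 : B := of_entries (total_sum F)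
  (fun y x => if m x y then g x y else 0).
have h0E y x : entry h0 y x = if m x y then g x y else 0 by apply: of_entriesK.
have ee : e * e = e by rewrite [LHS]bip_idemI setIid.
have eh0 : e * h0 = h0.
  apply: entry_inj => y x; rewrite [LHS]entry_idem_comp h0E.
  by case: ifPn => //; case: ifP => // /m_in /andP [-> _].
have h0e : h0 * e = h0.
  apply: entry_inj => y x; rewrite [LHS]entry_comp_idem h0E.
  by case: ifPn => //; case: ifP => // /m_in /andP [_ ->].
have DD : D * D = 0 by exact: (total_dd F thinP balP).
have eI : e * dI = dI by rewrite /dI !mulrA ee.
have dIe : dI * e = dI by rewrite /dI -!mulrA ee.
have dd : dI * dI = 0.
  (* Either form of stability lets one inner [e] be dropped, which exposes [D * D]. *)
  case: idealI => De; rewrite /dI -De.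
    have -> : D * e * (D * e) = D * (e * D * e) by rewrite !mulrA.
    by rewrite -De mulrA DD mul0r.
  have -> : e * D * (e * D) = e * D * e * D by rewrite !mulrA.
  by rewrite -De -mulrA DD mulr0.
have degD : supported dI (fun x y => rk y == (rk x).+1).
  move=> x y nR; rewrite entry_dI; case: ifP => // /and3P [_ _ /(thin_rank thinP)].
  by move=> rxy; rewrite rxy eqxx in nR.
have degh0 : supported h0 (fun x y => rk x == (rk y).+1).
  move=> x y nR; rewrite h0E; case: ifP => // /m_covers/(thin_rank thinP).
  by move=> rxy; rewrite rxy eqxx in nR.
pose x := e - dI * h0 - h0 * dI.
(* Since [x] preserves the rank, the series in [x] leaves the rank shift of [h0] intact. *)
have degx : supported x (fun a b => rk a == rk b).
  apply: supportedB; first apply: supportedB.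
  - exact: supported_idem.
  - apply: supported_comp degD degh0 => a b z /eqP -> /eqP ->.
    by [].
  - apply: supported_comp degh0 degD => a b z /eqP + /eqP.
    by move=> -> [->].
(* A nonzero term goes down a matched edge from [a] to [y], then up an unmatched one to [b]; both
   moves lower [rho]. *)
have dh0_0 a b y : (a != b) || (a \notin I) -> ~~ (rho b < rho a)%N ->
    entry dI y b \oc entry h0 a y = 0.
  move=> ab; apply: contraNeq; rewrite h0E entry_dI.
  case: ifPn => [/and3P [yI bI yb]|]; last by rewrite comp0c eqxx.
  case: ifPn => mya; last by rewrite compc0 eqxx.
  move=> _; have /andP [_ aI] := m_in mya; rewrite aI orbF in ab.
  apply: ltn_trans (rho_down mya); apply: rho_up => //.
  by apply: contraNN ab => myb; rewrite (m_fun mya myb).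
(* Likewise with an unmatched edge up first; it is unmatched because [m_inj] would otherwise give
   [a = b]. *)
have h0d_0 a b y : (a != b) || (a \notin I) -> ~~ (rho b < rho a)%N ->
    entry h0 y b \oc entry dI a y = 0.
  move=> ab; apply: contraNeq; rewrite h0E entry_dI.
  case: ifPn => mby; last by rewrite comp0c eqxx.
  case: ifPn => [/and3P [aI yI ay]|]; last by rewrite compc0 eqxx.
  move=> _; rewrite aI orbF in ab.
  apply: ltn_trans (rho_down mby) _; apply: rho_up => //.
  by apply: contraNN ab => may; rewrite (m_inj may mby).
have trix : supported x (fun a b => rho b < rho a)%N.
  move=> a b nlt; have -> : entry x a b = entry e a b
      - (\sum_y entry dI y b \oc entry h0 a y)
      - (\sum_y entry h0 y b \oc entry dI a y).
    by rewrite -!entry_comp -!entryB.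
  rewrite entry_idem.
  have [abI|] := boolP ((a != b) || (a \notin I)).
    rewrite !big1; try by move=> y _; rewrite ?dh0_0 ?h0d_0.
    rewrite !subr0; case: ifP => // aI; rewrite aI orbF in abI; exact: entry_id.
  rewrite negb_or !negbK => /andP [/eqP <- aI]; rewrite aI.
  have -> : entry (idc (bip_ob (total_sum F))) a a = idc (F a).
    by rewrite /entry compc1 bip_prj_inj.
  (* On the diagonal, [a] is the lower or the upper end of one matched edge, and [m_stop] excludes
     being both. So exactly one of the two sums is nonzero; its only term is the identity, which
     cancels [e]. *)
  have [y] := m_complete aI; case/orP => [may|mya].
    rewrite big1 ?subr0 => [|z _]; last first.
      rewrite h0E ifN ?compc0 //; apply: contraTN may; exact: m_stop.
    have /andP [_ yI] := m_in may.
    rewrite (bigD1 y) //= h0E entry_dI may aI yI m_covers //= (gP _ _ may).1.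
    rewrite big1 ?addr0 ?subrr // => z zy; rewrite h0E ifN ?comp0c //.
    by apply: contra zy => /(m_fun may) ->.
  have /andP [yI _] := m_in mya.
  rewrite [X in _ - _ - X]big1 ?subr0 => [|z _]; last first.
    by rewrite h0E ifN ?comp0c //; apply: m_stop mya.
  rewrite (bigD1 y) //= h0E entry_dI mya aI yI m_covers //= (gP _ _ mya).2.
  rewrite big1 ?addr0 ?subrr // => z zy; rewrite h0E ifN ?compc0 //.
  by apply: contra zy => mza; rewrite (m_inj mza mya).
have [n xn] := supported_nilpotent trix.
have [ek ke ctr] := nilpotent_contraction dd eI dIe ee eh0 h0e xn.
exists (h0 * \sum_(i < n) x ^+ i); split=> //.
apply: (supported_comp (R := fun a b => rk a == (rk b).+1)
                       (R' := fun a b => rk a == rk b)) => //.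
  by move=> a b z /eqP ->.
apply: supported_sum => i; apply: supportedX => // [a b z /eqP ->] //.
Qed.

End MatchingContraction.

(** * The matching on the ideal, transported to the whole poset *)

Section IdealContraction.
Context {disp : Order.disp_t} {P : finPOrderType disp} {A : abelianCat}.
Variables (rk : P -> nat) (c : P -> P -> int) (F : poset_functor P A).
Hypotheses (thinP : is_thin rk) (balP : is_balanced_coloring rk c).
Variable I : {set P}.

Let B := endo (bip_ob (total_sum F)).
Let e : B := bip_idem (total_sum F) I.
Let D : B := total_d c F.

(** Covers go up, so the summands in an upper ideal form a subcomplex and those in a lower ideal a
    quotient complex. *)
Lemma ideal_total_d : upper_ideal I \/ lower_ideal I ->
  D * e = e * D * e \/ e * D = e * D * e.
Proof.
case=> idI; [left | right].
  rewrite [RHS](idem_comp_supported (R := covers)) //.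
    by move=> x y /coversW; apply: idI.
  exact: supported_total_d.
apply: entry_inj => x y.
rewrite [LHS]entry_idem_comp [RHS]entry_comp_idem [in RHS]entry_idem_comp.
case: ifPn => yI; last by rewrite if_same.
case: ifPn => // xI; rewrite supported_total_d //.
by apply: contra xI => /coversW/idI ->.
Qed.

Variable M : {set subposet I * subposet I}.
Hypotheses (matchM : is_matching covers M) (completeM : complete_matching M)
  (acyclicM : acyclic_matching covers M)
  (isoM : forall (x y : subposet I) (xy : (x <= y)%O),
     (x, y) \in M -> is_iso (fmor (restrict F I) xy))
  (idealI : upper_ideal I \/ lower_ideal I).

Lemma acyclic_matching_contraction : exists h : B,
  [/\ e * h = h, h * e = h, e * D * e * h + h * (e * D * e) = e &
      supported h (fun x y => rk x == (rk y).+1)].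
Proof.
have [M_edge M_disj] := matchM.
have [rho0 rhoP] := acyclic_rank acyclicM.
(* The default 0 outside [I] is harmless: the conditions on [rho] compare elements of [I] only. *)
pose rho x := if insub x is Some u then rho0 u else 0%N.
have rhoE (u : subposet I) : rho (val u) = rho0 u by rewrite /rho valK.
pose m x y := [exists p in M, (val p.1 == x) && (val p.2 == y)].
have mE (u v : subposet I) : m (val u) (val v) = ((u, v) \in M).
  apply/exists_inP/idP => [[[u' v'] uvM]|uvM].
    by case/andP => /eqP/val_inj <- /eqP/val_inj <-.
  by exists (u, v); rewrite ?eqxx.
have mP x y : m x y -> exists u v : subposet I, [/\ val u = x, val v = y & (u, v) \in M].
  by case/exists_inP => -[u v] uvM /andP [/eqP xE /eqP yE]; exists u, v.
have coversE (u v : subposet I) : covers u v = covers (val u) (val v).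
  apply: sub_covers => x y z xy yz xI zI.
  by case: idealI => idI; [apply: idI xy xI | apply: idI yz zI].
have inI x : x \in I -> exists u : subposet I, val u = x.
  by move=> xI; exists (Sub x xI).
apply: (matching_contraction thinP balP (m := m) (rho := rho)).
- by move=> x y /mP [u [v [<- <- _]]]; rewrite (valP u) (valP v).
- by move=> x y /mP [u [v [<- <- /M_edge]]]; rewrite coversE.
- move=> x /inI [u <-]; have [[a b] abM] := completeM u.
  case/orP => /eqP /= ->; [exists (val b) | exists (val a)]; by rewrite !mE abM ?orbT.
- move=> x y z /mP [u [v [<- <- uvM]]] /mP [u' [w [/val_inj uE <- uwM]]].
  rewrite uE in uwM; have [-> //] : (u, v) = (u, w).
  by apply: (M_disj _ _ u); rewrite // /incident eqxx.
- move=> x y z /mP [u [v [<- <- uvM]]] /mP [w [v' [<- /val_inj vE wvM]]].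
  rewrite vE in wvM; have [-> //] : (u, v) = (w, v).
  by apply: (M_disj _ _ v); rewrite // /incident eqxx orbT.
- move=> x y z /mP [u [v [_ <- uvM]]].
  apply/negP => /mP [v' [w [/val_inj vE _ vwM]]]; rewrite {}vE in vwM.
  (* Two matched edges meeting at [v] coincide, which would make [u] cover itself. *)
  have [uE _] : (u, v) = (v, w).
    by apply: (M_disj _ _ v); rewrite // /incident eqxx ?orbT.
  by have := M_edge _ uvM; rewrite uE /covers ltxx.
- move=> x y /mP [u [v [<- <- uvM]]].
  have uv : (u <= v)%O := coversW (M_edge _ uvM).
  by have := isoM uv uvM; rewrite /= /restrict_mor -fmor0E.
- move=> x y /inI [u <-] /inI [v <-]; rewrite -coversE mE !rhoE => uv nuv.
  by apply: rhoP; rewrite /reverse_matching uv nuv.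
- move=> x y /mP [u [v [<- <- uvM]]]; rewrite !rhoE; apply: rhoP.
  by rewrite /reverse_matching (M_edge _ uvM) uvM orbT.
- exact: ideal_total_d.
Qed.

End IdealContraction.

Local Open Scope order_scope.

Theorem theorem3p3 (d : Order.disp_t) (P : finPOrderType d)
    (rk : P -> nat) (thinP : is_thin rk)
    (c : P -> P -> int) (balP : is_balanced_coloring rk c)
    (A : abelianCat) (F : poset_functor P A)
    (I : {set P}) (idealI : upper_ideal I \/ lower_ideal I)
    (M : {set subposet I * subposet I})
    (matchM : is_matching covers M)
    (completeM : complete_matching M)
    (acyclicM : acyclic_matching covers M)
    (isoM : forall (x y : subposet I) (xy : x <= y),
       (x, y) \in M -> is_iso (fmor (restrict F I) xy)) :
  let convI := ideal_compl_convex idealI in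
  forall k : nat,
    isomorphic
      (cohomology (poset_complex thinP balP F) k)
      (cohomology (poset_complex (sub_is_thin convI thinP)
                                 (sub_is_balanced convI balP)
                                 (restrict F (~: I))) k).
Proof.
move=> convI k.
have [h [eh he ctr degh]] :=
  acyclic_matching_contraction thinP balP matchM completeM acyclicM isoM idealI.
have DD := total_dd F thinP balP.
have ee : bip_idem (total_sum F) I \oc bip_idem (total_sum F) I = bip_idem _ I.
  by rewrite bip_idemI setIid.
(* Naming [endo] explicitly lets the ring lemma accept hypotheses stated with [\oc]. *)
have [pqp qppq qchain chainq] :=
  @contraction_perturbation (endo (bip_ob (total_sum F))) _ _ _ _ _
  (bip_idemC (total_sum F) I) erefl DD ee (ideal_total_d c F idealI) eh he ctr.
apply: (graded_retract_cohomology
  (X := poset_complex thinP balP F)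
  (Y := poset_complex (sub_is_thin convI thinP) (sub_is_balanced convI balP)
    (restrict F (~: I)))
  (rank_injK rk F) (@res_injK _ _ _ rk F (~: I))
  (rank_prjK rk F) _ _ _ (cochain_dE rk c F) (res_cochain_dE rk c F convI)
  (D := total_d c F) (h := h) _ _ _ erefl pqp qppq qchain chainq).
- by move=> j; rewrite res_prjK bip_idemI.
- by rewrite bip_idemI setIid.
- by move=> j; rewrite !bip_idemI setIC.
- move=> j; apply: (idem_comp_supported (R := covers)).
    by move=> x y /(thin_rank thinP) ryx; rewrite !inE ryx.
  exact: supported_total_d.
(* An entry of [h] leaving rank 0 would have to reach a rank whose successor is 0. *)
- apply: entry_inj => x y; rewrite entry_comp_idem entry0 inE.
  by case: eqP => // rx; rewrite degh // rx.
- move=> j; apply: (idem_comp_supported _ degh) => x y /eqP rxy.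
  by rewrite !inE rxy.
Qed.
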